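(* Let $(A,T)$ be a Rota-Baxter algebra of weight $\lambda$ and $(M,T_M)$ a Rota-Baxter bimodule over it. Two cohomologous $2$-cocycles $(\psi_1,\chi_1)$ and $(\psi_2,\chi_2)$ of $\mathrm{C}^\bullet_{\mathrm{RBA}_\lambda}(A,M)$ give rise to isomorphic abelian extensions $(A\oplus M,\cdot_{\psi_1},T_{\chi_1})$ and $(A\oplus M,\cdot_{\psi_2},T_{\chi_2})$ of $(A,T)$ by $(M,T_M)$.
   Context: $\mathbf{k}$ is a field of characteristic $0$, $\lambda\in\mathbf{k}$; everything is over $\mathbf{k}$. A Rota-Baxter algebra of weight $\lambda$ is an associative algebra $A$ with a linear map $T:A\to A$ such that $T(a)T(b)=T(aT(b)+T(a)b+\lambda ab)$. A Rota-Baxter bimodule over $(A,T)$ is an $A$-bimodule $M$ with a linear map $T_M:M\to M$ such that $T(a)T_M(m)=T_M(aT_M(m)+T(a)m+\lambda am)$ and $T_M(m)T(a)=T_M(mT(a)+T_M(m)a+\lambda ma)$. Write $a_{i,j}=a_i\otimes\cdots\otimes a_j$ (empty if $i>j$). **Abelian extensions.** View $(M,T_M)$ as a Rota-Baxter algebra with zero multiplication. An abelian extension of $(A,T)$ by $(M,T_M)$ is a short exact sequence of morphisms of Rota-Baxter algebras $0\to(M,T_M)\xrightarrow{i}(\hat A,\hat T)\xrightarrow{p}(A,T)\to0$. Two abelian extensions $(\hat A_1,\hat T_1)$, $(\hat A_2,\hat T_2)$ are isomorphic if there is an isomorphism of Rota-Baxter algebras $\zeta:\hat A_1\to\hat A_2$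 inducing the identity on $M$ and on $A$. For linear maps $\psi:A\otimes A\to M$, $\chi:A\to M$ set $(a,m)\cdot_\psi(b,n)=(ab,an+mb+\psi(a\otimes b))$ and $T_\chi(a,m)=(T(a),\chi(a)+T_M(m))$ on $A\oplus M$; when $(\psi,\chi)$ is a $2$-cocycle of $\mathrm{C}^\bullet_{\mathrm{RBA}_\lambda}(A,M)$ this is a Rota-Baxter algebra and, with $m\mapsto(0,m)$ and $(a,m)\mapsto a$, an abelian extension of $(A,T)$ by $(M,T_M)$. **Cochain complex.** Let $\mathrm{C}^n_{\mathrm{Alg}}(A,M)=\mathrm{C}^n_{\mathrm{RBO}_\lambda}(A,M)=\mathrm{Hom}(A^{\otimes n},M)$, $n\geqslant0$. - $\delta^n(f)(a_{1,n+1})=(-1)^{n+1}a_1f(a_{2,n+1})+\sum_{i=1}^n(-1)^{n-i+1}f(a_{1,i-1}\otimes a_ia_{i+1}\otimes a_{i+2,n+1})+f(a_{1,n})a_{n+1}$. - With $a\star b=aT(b)+T(a)b+\lambda ab$, $a\rhd m=T(a)m-T_M(am)$, $m\lhd a=mT(a)-T_M(ma)$: $\partial^n(f)(a_{1,n+1})=(-1)^{n+1}a_1\rhd f(a_{2,n+1})+\sum_{i=1}^n(-1)^{n-i+1}f(a_{1,i-1}\otimes a_i\star a_{i+1}\otimes a_{i+2,n+1})+f(a_{1,n})\lhd a_{n+1}$. - $\Phi^0=\mathrm{Id}$ and for $n\geqslant1$: $\Phi^n(f)(a_{1,n})=f(T(a_1)\otimes\cdots\otimes T(a_n))-\sum_{k=0}^{n-1}\lambda^{n-k-1}\sum_{1\leqslant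 i_1<\cdots<i_k\leqslant n}T_M\circ f(a_{1,i_1-1}\otimes T(a_{i_1})\otimes a_{i_1+1,i_2-1}\otimes T(a_{i_2})\otimes\cdots\otimes T(a_{i_k})\otimes a_{i_k+1,n})$. - $\mathrm{C}^0_{\mathrm{RBA}_\lambda}(A,M)=\mathrm{C}^0_{\mathrm{Alg}}(A,M)$, $\mathrm{C}^n_{\mathrm{RBA}_\lambda}(A,M)=\mathrm{C}^n_{\mathrm{Alg}}(A,M)\oplus\mathrm{C}^{n-1}_{\mathrm{RBO}_\lambda}(A,M)$ for $n\geqslant1$, with $d^n(f,g)=(\delta^n(f),-\partial^{n-1}(g)-\Phi^n(f))$. Two $2$-cocycles are cohomologous if they differ by an element of the image of $d^1$. *)

(* Defs.v *)
From HB Require Import structures.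
From mathcomp Require Import all_boot all_algebra.
From mathcomp Require Import functions.

Set Implicit Arguments.
Unset Strict Implicit.
Unset Printing Implicit Defensive.

Import GRing.Theory.
Local Open Scope ring_scope.

(* Algebras are not required to be unital: a module M with zero multiplication
   has to be an algebra too. This is why the ring structures of the library
   are not used here. *)
Record rb_algebra (K : fieldType) (lambda : K) := RBAlgebra {
  rba_sort :> lmodType K;
  rba_mul : {bilinear rba_sort -> rba_sort -> rba_sort};
  rba_op : {linear rba_sort -> rba_sort};
  rba_mulA : associative rba_mul;
  rba_opM : forall a b : rba_sort,
    rba_mul (rba_op a) (rba_op b) =
    rba_op (rba_mul a (rba_op b) + rba_mul (rba_op a) b
            + lambda *: rba_mul a b)
}.
Arguments rba_mul {K lambda}.
Arguments rba_op {K lambda}.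

Record rb_bimodule (K : fieldType) (lambda : K) (A : rb_algebra lambda) :=
  RBBimodule {
  rbm_sort :> lmodType K;
  rbm_lact : {bilinear A -> rbm_sort -> rbm_sort};
  rbm_ract : {bilinear rbm_sort -> A -> rbm_sort};
  rbm_op : {linear rbm_sort -> rbm_sort};
  rbm_lactA : forall (a b : A) (m : rbm_sort),
    rbm_lact (rba_mul A a b) m = rbm_lact a (rbm_lact b m);
  rbm_ractA : forall (m : rbm_sort) (a b : A),
    rbm_ract m (rba_mul A a b) = rbm_ract (rbm_ract m a) b;
  rbm_lractA : forall (a : A) (m : rbm_sort) (b : A),
    rbm_ract (rbm_lact a m) b = rbm_lact a (rbm_ract m b);
  rbm_opl : forall (a : A) (m : rbm_sort),
    rbm_lact (rba_op A a) (rbm_op m) =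
    rbm_op (rbm_lact a (rbm_op m) + rbm_lact (rba_op A a) m
            + lambda *: rbm_lact a m);
  rbm_opr : forall (m : rbm_sort) (a : A),
    rbm_ract (rbm_op m) (rba_op A a) =
    rbm_op (rbm_ract m (rba_op A a) + rbm_ract (rbm_op m) a
            + lambda *: rbm_ract m a)
}.
Arguments rbm_lact {K lambda A}.
Arguments rbm_ract {K lambda A}.
Arguments rbm_op {K lambda A}.

Record rb_morphism (K : fieldType) (lambda : K) (A B : rb_algebra lambda) :=
  RBMorphism {
  rb_fun :> {linear A -> B};
  rb_funM : forall a b : A,
    rb_fun (rba_mul A a b) = rba_mul B (rb_fun a) (rb_fun b);
  rb_fun_op : forall a : A, rb_fun (rba_op A a) = rba_op B (rb_fun a)
}.

Section ZeroMultiplication.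
Variables (K : fieldType) (lambda : K) (A : rb_algebra lambda).
Variable M : rb_bimodule A.

Definition zero_mul (m n : M) : M := 0.

Fact zero_mul_bilinear : bilinear_for *:%R *:%R zero_mul.
Proof. by split=> u c x y /=; rewrite /zero_mul [RHS]addr0 [RHS]scaler0. Qed.

HB.instance Definition _ :=
  bilinear_isBilinear.Build K M M M *:%R *:%R zero_mul zero_mul_bilinear.

Fact zero_mulA : associative zero_mul.
Proof. by []. Qed.

Fact zero_mul_op (m n : M) :
  zero_mul (rbm_op M m) (rbm_op M n) =
  rbm_op M (zero_mul m (rbm_op M n) + zero_mul (rbm_op M m) n
            + lambda *: zero_mul m n).
Proof. by rewrite /zero_mul scaler0 !addr0 linear0. Qed.

Definition zero_rb_algebra : rb_algebra lambda :=
  @RBAlgebra K lambda M zero_mul (rbm_op M) zero_mulA zero_mul_op.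

End ZeroMultiplication.

Record abelian_extension (K : fieldType) (lambda : K) (A : rb_algebra lambda)
    (M : rb_bimodule A) := AbelianExtension {
  ext_total :> rb_algebra lambda;
  ext_inj : rb_morphism (zero_rb_algebra M) ext_total;
  ext_proj : rb_morphism ext_total A;
  ext_inj_injective : injective ext_inj;
  ext_exact : forall x : ext_total,
    ext_proj x = 0 <-> exists m : M, ext_inj m = x;
  ext_proj_surjective : forall a : A, exists x : ext_total, ext_proj x = a
}.

(* A bijective morphism is an isomorphism: its inverse is again linear,
   multiplicative and compatible with the operators. *)
Definition isomorphic_extensions (K : fieldType) (lambda : K)
    (A : rb_algebra lambda) (M : rb_bimodule A)
    (E1 E2 : abelian_extension M) : Prop :=
  exists zeta : rb_morphism E1 E2,
    [/\ bijective zeta,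
        forall m : M, zeta (ext_inj E1 m) = ext_inj E2 m &
        forall x : E1, ext_proj E2 (zeta x) = ext_proj E1 x].

Section Cochains.
Variables (K : fieldType) (lambda : K) (A : rb_algebra lambda).
Variable M : rb_bimodule A.
Local Notation T := (rba_op A).
Local Notation TM := (rbm_op M).

(* Hom(A^{(x) n}, M) is rendered as the n-linear maps A^n -> M: cochains are
   functions of a family {ffun 'I_n -> A} satisfying [multilinear]. Indices
   start from 0, so a_{i+1} is the value of the family at i. *)
Definition upd n (a : {ffun 'I_n -> A}) (i : 'I_n) (x : A) : {ffun 'I_n -> A} :=
  [ffun j => if j == i then x else a j].

Definition multilinear n (f : {ffun 'I_n -> A} -> M) : Prop :=
  forall (a : {ffun 'I_n -> A}) (i : 'I_n) (c : K) (x y : A),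
    f (upd a i (c *: x + y)) = c *: f (upd a i x) + f (upd a i y).

Definition behead_ffun n (a : {ffun 'I_n.+1 -> A}) : {ffun 'I_n -> A} :=
  [ffun j => a (lift ord0 j)].

Definition belast_ffun n (a : {ffun 'I_n.+1 -> A}) : {ffun 'I_n -> A} :=
  [ffun j => a (lift ord_max j)].

(* Replaces the entries at i and i+1 by their product under mu. *)
Definition merge_ffun (mu : A -> A -> A) n (i : 'I_n)
    (a : {ffun 'I_n.+1 -> A}) : {ffun 'I_n -> A} :=
  [ffun j : 'I_n =>
    if (j < i)%N then a (widen_ord (leqnSn n) j)
    else if j == i then mu (a (widen_ord (leqnSn n) j)) (a (lift ord0 j))
    else a (lift ord0 j)].

(* Common shape of delta and partial. For 0-based i the sign (-1)^(n-i+1)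
   becomes (-1)^(n-i). *)
Definition hochschild (mu : A -> A -> A) (l : A -> M -> M) (r : M -> A -> M)
    n (f : {ffun 'I_n -> A} -> M) (a : {ffun 'I_n.+1 -> A}) : M :=
  (-1) ^+ n.+1 *: l (a ord0) (f (behead_ffun a))
  + \sum_(i < n) (-1) ^+ (n - i) *: f (merge_ffun mu i a)
  + r (f (belast_ffun a)) (a ord_max).

Definition delta := hochschild (rba_mul A) (rbm_lact M) (rbm_ract M).

Definition star (a b : A) : A :=
  rba_mul A a (T b) + rba_mul A (T a) b + lambda *: rba_mul A a b.

Definition lact_op (a : A) (m : M) : M :=
  rbm_lact M (T a) m - TM (rbm_lact M a m).

Definition ract_op (m : M) (a : A) : M :=
  rbm_ract M m (T a) - TM (rbm_ract M m a).

Definition partial := hochschild star lact_op ract_op.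

(* Increasing sequences i_1 < ... < i_k are encoded as k-element subsets S. *)
Definition Phi n (f : {ffun 'I_n -> A} -> M) (a : {ffun 'I_n -> A}) : M :=
  if n is 0 then f a else
  f [ffun j => T (a j)]
  - \sum_(k < n) lambda ^+ (n - k - 1) *:
      \sum_(S : {set 'I_n} | #|S| == k :> nat)
        TM (f [ffun j => if j \in S then T (a j) else a j]).

(* Ambient module of the degree n part; the cochains proper are cut out by
   [is_rba_cochain]. *)
Definition rba_cochain (n : nat) : lmodType K :=
  if n is m.+1
  then (({ffun 'I_m.+1 -> A} -> M) * ({ffun 'I_m -> A} -> M))%type
  else {ffun 'I_0 -> A} -> M.

Definition is_rba_cochain n : rba_cochain n -> Prop :=
  match n with
  | 0 => fun f => multilinear f
  | m.+1 => fun c => multilinear c.1 /\ multilinear c.2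
  end.

Definition rba_d n : rba_cochain n -> rba_cochain n.+1 :=
  match n with
  | 0 => fun f => (delta f, - Phi f)
  | m.+1 => fun c => (delta c.1, - partial c.2 - Phi c.1)
  end.

Record rba_cocycle n := RBACocycle {
  cocycle_val :> rba_cochain n;
  cocycle_cochain : is_rba_cochain cocycle_val;
  cocycle_closed : rba_d cocycle_val = 0
}.

Definition cohomologous n (c1 c2 : rba_cocycle n.+1) : Prop :=
  exists b : rba_cochain n,
    is_rba_cochain b /\ cocycle_val c1 - cocycle_val c2 = rba_d b.

End Cochains.

Section CocycleExtension.
Variables (K : fieldType) (lambda : K) (A : rb_algebra lambda).
Variable M : rb_bimodule A.
Local Notation T := (rba_op A).
Local Notation TM := (rbm_op M).

Definition ffun1 (a : A) : {ffun 'I_1 -> A} := [ffun => a].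

Definition ffun2 (a b : A) : {ffun 'I_2 -> A} :=
  [ffun i => if i == ord0 then a else b].

Definition psi_of (c : rba_cocycle M 2) (a b : A) : M :=
  (cocycle_val c).1 (ffun2 a b).

Definition chi_of (c : rba_cocycle M 2) (a : A) : M :=
  (cocycle_val c).2 (ffun1 a).

Definition ext_mul (c : rba_cocycle M 2) (x y : A * M) : A * M :=
  (rba_mul A x.1 y.1,
   rbm_lact M x.1 y.2 + rbm_ract M x.2 y.1 + psi_of c x.1 y.1).

Definition ext_op (c : rba_cocycle M 2) (x : A * M) : A * M :=
  (T x.1, chi_of c x.1 + TM x.2).

Variable c : rba_cocycle M 2.

Fact psi_of_bilinear : bilinear_for *:%R *:%R (psi_of c).
Proof.
have [psiL _] := cocycle_cochain c.
split=> u k x y /=; rewrite /psi_of.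
- have E z : ffun2 z u = upd [ffun=> u] ord0 z.
    by apply/ffunP=> i; rewrite !ffunE; case: eqP.
  by rewrite !E psiL.
- have E z : ffun2 u z = upd [ffun=> u] ord_max z.
    by apply/ffunP=> i; rewrite !ffunE; case: i => [[|[|]]].
  by rewrite !E psiL.
Qed.

Fact chi_of_linear : linear (chi_of c).
Proof.
have [_ chiL] := cocycle_cochain c.
move=> k x y /=; rewrite /chi_of.
have E z : ffun1 z = upd [ffun=> 0] ord0 z.
  by apply/ffunP=> i; rewrite !ffunE ord1.
by rewrite !E chiL.
Qed.


Fact psi_of_closed (a b d : A) :
  psi_of c (rba_mul A a b) d + rbm_ract M (psi_of c a b) d =
  rbm_lact M a (psi_of c b d) + psi_of c a (rba_mul A b d).
Proof.
pose t : {ffun 'I_3 -> A} := [ffun i : 'I_3 => nth 0 [:: a; b; d] i].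
have /(congr1 (fun f => f.1 t)) := cocycle_closed c.
rewrite /= /delta /hochschild !big_ord_recl big_ord0 addr0 /=.
have -> : behead_ffun t = ffun2 b d.
  by apply/ffunP=> i; rewrite !ffunE; case: i => [[|[|]]].
have -> : belast_ffun t = ffun2 a b.
  by apply/ffunP=> i; rewrite !ffunE; case: i => [[|[|]]].
have -> : merge_ffun (rba_mul A) ord0 t = ffun2 (rba_mul A a b) d.
  by apply/ffunP=> i; rewrite !ffunE; case: i => [[|[|]]].
have -> : merge_ffun (rba_mul A) (lift ord0 ord0) t = ffun2 a (rba_mul A b d).
  by apply/ffunP=> i; rewrite !ffunE; case: i => [[|[|]]].
rewrite !ffunE -(signr_odd _ 3) -(signr_odd _ (2 - 0)).
rewrite -(signr_odd _ (2 - bump 0 0)) /= !scaleN1r scale1r => E.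
apply/subr0_eq; rewrite -[RHS]E opprD.
by rewrite [LHS](AC (2*2) ((3*(1*4))*2)).
Qed.

Fact chi_of_closed (a b : A) :
  rbm_lact M (T a) (chi_of c b) + rbm_ract M (chi_of c a) (T b)
  + psi_of c (T a) (T b) =
  chi_of c (star a b)
  + TM (rbm_lact M a (chi_of c b) + rbm_ract M (chi_of c a) b
        + psi_of c a (T b) + psi_of c (T a) b + lambda *: psi_of c a b).
Proof.
have sum0 (F : {set 'I_2} -> M) : \sum_(S : {set 'I_2} | #|S| == 0%N) F S = F set0.
  by apply: big_pred1 => S; rewrite cards_eq0.
have sum1 (F : {set 'I_2} -> M) :
    \sum_(S : {set 'I_2} | #|S| == 1%N) F S = F [set ord0] + F [set ord_max].
  transitivity (\sum_(S in [set [set i] | i in 'I_2]) F S).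
    apply: eq_bigl => S; apply/cards1P/imsetP => [[i ->]|[i _ ->]];
      by exists i.
  rewrite big_imset /=; last by move=> i j _ _; apply: set1_inj.
  rewrite !big_ord_recl big_ord0 addr0; congr (_ + F [set _]).
  exact: val_inj.
have : - partial (cocycle_val c).2 (ffun2 a b)
    - Phi (cocycle_val c).1 (ffun2 a b) = 0 :=
  congr1 (fun f => f.2 (ffun2 a b)) (cocycle_closed c).
rewrite /partial /Phi /hochschild !big_ord_recl !big_ord0 !addr0 /=.
rewrite sum0 sum1.
have -> : behead_ffun (ffun2 a b) = ffun1 b.
  by apply/ffunP=> i; rewrite !ffunE.
have -> : belast_ffun (ffun2 a b) = ffun1 a.
  by apply/ffunP=> i; rewrite !ffunE ord1.
have -> : merge_ffun (star (A := A)) ord0 (ffun2 a b) = ffun1 (star a b).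
  by apply/ffunP=> i; rewrite !ffunE ord1.
have -> : [ffun j => T (ffun2 a b j)] = ffun2 (T a) (T b).
  by apply/ffunP=> i; rewrite !ffunE; case: ifP.
have -> : [ffun j : 'I_2 => if j \in set0 then T (ffun2 a b j)
                            else ffun2 a b j] = ffun2 a b.
  by apply/ffunP=> i; rewrite !ffunE in_set0.
have -> : [ffun j : 'I_2 => if j \in [set ord0] then T (ffun2 a b j)
                            else ffun2 a b j] = ffun2 (T a) b.
  by apply/ffunP=> i; rewrite !ffunE in_set1; case: (i == ord0).
have -> : [ffun j : 'I_2 => if j \in [set ord_max] then T (ffun2 a b j)
                            else ffun2 a b j] = ffun2 a (T b).
  by apply/ffunP=> i; rewrite !ffunE in_set1; case: i => [[|[|]]].
rewrite !ffunE /= -(signr_odd _ 2) /= expr0 expr1 !scale1r scaleN1r.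
rewrite /lact_op /ract_op.
rewrite !opprD !opprK !addrA => E.
apply/esym/subr0_eq; rewrite -[RHS]E !linearD linearZ /=.
rewrite !addrA [lambda ^+ _]expr1.
by rewrite [LHS](ACl (7*2*1*8*3*9*6*5*4)).
Qed.

HB.instance Definition _ :=
  bilinear_isBilinear.Build K A A M *:%R *:%R (psi_of c) psi_of_bilinear.

HB.instance Definition _ :=
  GRing.isLinear.Build K A M *:%R (chi_of c) chi_of_linear.

Fact ext_mul_bilinear : bilinear_for *:%R *:%R (ext_mul c).
Proof.
split=> u k x y /=; rewrite /ext_mul /=; congr (_, _); rewrite /=.
- by rewrite linearPl.
- by rewrite !linearPl /= !scalerDr [LHS](AC (2*2*2) ((1*3*5)*(2*4*6))).
- by rewrite linearPr.
- by rewrite !linearPr /= !scalerDr [LHS](AC (2*2*2) ((1*3*5)*(2*4*6))).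
Qed.

HB.instance Definition _ :=
  bilinear_isBilinear.Build K (A * M)%type (A * M)%type (A * M)%type
    *:%R *:%R (ext_mul c) ext_mul_bilinear.

Fact ext_op_linear : linear (ext_op c).
Proof.
move=> k x y; rewrite /ext_op /=; congr (_, _); rewrite /= !linearP //=.
by rewrite scalerDr [LHS](AC (2*2) ((1*3)*(2*4))).
Qed.

HB.instance Definition _ :=
  GRing.isLinear.Build K (A * M)%type (A * M)%type *:%R (ext_op c)
    ext_op_linear.

Fact ext_mulA : associative (ext_mul c).
Proof.
move=> x y z; rewrite /ext_mul /=; congr (_, _); first exact: rba_mulA.
rewrite !linearDr !linearDl /= rbm_lactA rbm_ractA rbm_lractA.
have E := psi_of_closed x.1 y.1 z.1.
rewrite [LHS](AC (3*1*1) ((1*2*4)*(3*5))). rewrite /= -E.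
by rewrite [LHS](AC (3*2) ((1*(2*3*5))*4)).
Qed.

Fact ext_opM (x y : A * M) :
  ext_mul c (ext_op c x) (ext_op c y) =
  ext_op c (ext_mul c x (ext_op c y) + ext_mul c (ext_op c x) y
            + lambda *: ext_mul c x y).
Proof.
rewrite /ext_mul /ext_op /=; congr (_, _); first exact: rba_opM.
rewrite linearDr linearDl /= rbm_opl rbm_opr.
rewrite [LHS](AC (2*2*1) ((1*3*5)*2*4)) /= chi_of_closed -!addrA -!linearD.
congr (_ + TM _); first by rewrite /star addrA.
rewrite linearDr linearDl /= !scalerDr !addrA.
by rewrite [LHS](ACl (1*6*9*3*7*2*10*4*8*11*5)).
Qed.

Definition cocycle_rb_algebra : rb_algebra lambda :=
  @RBAlgebra K lambda (A * M)%type (ext_mul c) (ext_op c) ext_mulA ext_opM.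

Definition ext_incl (m : zero_rb_algebra M) : cocycle_rb_algebra := (0, m).

Fact ext_incl_linear : linear ext_incl.
Proof.
by move=> k m n; congr (_, _); rewrite /= scaler0 addr0.
Qed.

HB.instance Definition _ :=
  GRing.isLinear.Build K (zero_rb_algebra M) cocycle_rb_algebra *:%R ext_incl
    ext_incl_linear.

Fact ext_inclM (m n : zero_rb_algebra M) :
  ext_incl (rba_mul (zero_rb_algebra M) m n) =
  rba_mul cocycle_rb_algebra (ext_incl m) (ext_incl n).
Proof.
congr (_, _); rewrite /= ?linear0r //.
by rewrite [rbm_lact M 0 n]linear0l !addr0.
Qed.

Fact ext_incl_op (m : zero_rb_algebra M) :
  ext_incl (rba_op (zero_rb_algebra M) m) =
  rba_op cocycle_rb_algebra (ext_incl m).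
Proof. by congr (_, _); rewrite /= linear0 ?add0r. Qed.

Definition ext_pr (x : cocycle_rb_algebra) : A := x.1.

Fact ext_pr_linear : linear ext_pr.
Proof. by []. Qed.

HB.instance Definition _ :=
  GRing.isLinear.Build K cocycle_rb_algebra A *:%R ext_pr ext_pr_linear.

Fact ext_incl_injective : injective ext_incl.
Proof. by move=> m n []. Qed.

Fact ext_incl_pr_exact (x : cocycle_rb_algebra) :
  ext_pr x = 0 <-> exists m : M, ext_incl m = x.
Proof.
by split=> [|[m <-]//]; case: x => a m /= ->; exists m.
Qed.

Fact ext_pr_surjective (a : A) : exists x : cocycle_rb_algebra, ext_pr x = a.
Proof. by exists (a, 0). Qed.

Definition cocycle_extension : abelian_extension M :=
  @AbelianExtension K lambda A M cocycle_rb_algebra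
    (@RBMorphism K lambda _ _ ext_incl ext_inclM ext_incl_op)
    (@RBMorphism K lambda cocycle_rb_algebra A ext_pr
       (fun _ _ => erefl) (fun=> erefl))
    ext_incl_injective ext_incl_pr_exact ext_pr_surjective.

End CocycleExtension.

(* Main.v *)
Require Import Defs.
From HB Require Import structures.
From mathcomp Require Import all_boot all_algebra.

(** Any map of the form [(a, m) |-> (a, m + eta a)] with [eta : A -> M] linear
    is a linear bijection of [A * M] inducing the identity on [M] and on [A];
    [(a, m) |-> (a, m - eta a)] is its inverse.  Comparing second components,
    such a map is a morphism of Rota-Baxter algebras from the extension of
    [(psi1, chi1)] to that of [(psi2, chi2)] as soon as
    - [psi1 (a, b) - psi2 (a, b) = a eta(b) - eta(a b) + eta(a) b], and
    - [chi1 a - chi2 a = TM (eta a) - eta (T a)]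
    ([isomorphic_extensions_of_linear]).  These equations say that the two
    cocycles differ by [d^1 (eta, 0)].

    A general coboundary [d^1 (f, x)] also involves an element [x] of [M],
    which contributes [T(a) x - TM(a x) - x T(a) + TM(x a)] to the operator
    component and nothing to the product component.  This contribution is that
    of the inner derivation [D a = x a - a x]: being a derivation, it has
    [delta D = 0], while [TM (D a) - D (T a)] is exactly the above expression.
    Hence [d^1 (f, x) = d^1 (f + D, 0)], and [eta = f + D] gives the
    isomorphism. *)

Set Implicit Arguments.
Unset Strict Implicit.
Unset Printing Implicit Defensive.

Import GRing.Theory.
Local Open Scope ring_scope.

Section ShearIsomorphism.
Variables (K : fieldType) (lambda : K) (A : rb_algebra lambda).
Variables (M : rb_bimodule A) (c1 c2 : rba_cocycle M 2).
Variable eta : {linear A -> M}.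

Definition shear (x : cocycle_rb_algebra c1) : cocycle_rb_algebra c2 :=
  (x.1, x.2 + eta x.1).

Fact shear_linear : linear shear.
Proof.
move=> k x y; congr (_, _); rewrite /= linearP scalerDr.
by rewrite [LHS](AC (2*2) ((1*3)*(2*4))).
Qed.

HB.instance Definition _ :=
  GRing.isLinear.Build K (cocycle_rb_algebra c1) (cocycle_rb_algebra c2) *:%R
    shear shear_linear.

Lemma shear_bijective : bijective shear.
Proof.
exists (fun y => (y.1, y.2 - eta y.1)) => -[a m]; congr (_, _).
  exact: addrK.
exact: subrK.
Qed.

Hypothesis psi_eta : forall a b : A, psi_of c1 a b - psi_of c2 a b =
  rbm_lact M a (eta b) - eta (rba_mul A a b) + rbm_ract M (eta a) b.
Hypothesis chi_eta : forall a : A, chi_of c1 a - chi_of c2 a =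
  rbm_op M (eta a) - eta (rba_op A a).

Lemma shearM (x y : cocycle_rb_algebra c1) :
  shear (rba_mul _ x y) = rba_mul _ (shear x) (shear y).
Proof.
congr (_, _); rewrite /= linearDr linearDl /=.
have -> : psi_of c1 x.1 y.1 =
    rbm_lact M x.1 (eta y.1) - eta (rba_mul A x.1 y.1)
    + rbm_ract M (eta x.1) y.1 + psi_of c2 x.1 y.1.
  by rewrite -psi_eta subrK.
by rewrite !addrA [LHS](ACl (1*3*2*5*6*(4*7))) /= addNr addr0.
Qed.

Lemma shear_op (x : cocycle_rb_algebra c1) :
  shear (rba_op _ x) = rba_op _ (shear x).
Proof.
congr (_, _); rewrite /= linearD /=.
have -> : chi_of c1 x.1 =
    rbm_op M (eta x.1) - eta (rba_op A x.1) + chi_of c2 x.1.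
  by rewrite -chi_eta subrK.
by rewrite !addrA [LHS](ACl (3*4*1*(2*5))) /= addNr addr0.
Qed.

(** The hypotheses [psi_eta] and [chi_eta] are the equality of the second
    components in [shearM] and [shear_op]; the first components agree because
    [shear] is the identity on [A]. *)
Lemma isomorphic_extensions_of_linear :
  isomorphic_extensions (cocycle_extension c1) (cocycle_extension c2).
Proof.
exists (RBMorphism shearM shear_op); split => //.
- exact: shear_bijective.
- by move=> m; congr (_, _); rewrite /= linear0 addr0.
Qed.

End ShearIsomorphism.

Section InnerDerivation.
Variables (K : fieldType) (lambda : K) (A : rb_algebra lambda).
Variables (M : rb_bimodule A) (x : M).

Definition inner_derivation (a : A) : M := rbm_ract M x a - rbm_lact M a x.

Fact inner_derivation_linear : linear inner_derivation.
Proof.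
move=> k a b; rewrite /inner_derivation linearPr linearPl /= scalerBr opprD.
by rewrite [LHS](AC (2*2) ((1*3)*(2*4))).
Qed.

HB.instance Definition _ :=
  GRing.isLinear.Build K A M *:%R inner_derivation inner_derivation_linear.

(** The Leibniz rule says that the inner derivation is a cocycle for [delta],
    so that adding it to a map changes nothing in the product component. *)
Lemma inner_derivationM (a b : A) :
  inner_derivation (rba_mul A a b) =
  rbm_lact M a (inner_derivation b) + rbm_ract M (inner_derivation a) b.
Proof.
rewrite /inner_derivation linearBr linearBl /= rbm_ractA rbm_lactA rbm_lractA.
by rewrite [RHS](AC (2*2) (3*2*(1*4))) /= subrr addr0.
Qed.

End InnerDerivation.

Section LowDegreeCochains.
Variables (K : fieldType) (lambda : K) (A : rb_algebra lambda).
Variable M : rb_bimodule A.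

Definition empty_ffun : {ffun 'I_0 -> A} := [ffun => 0].

Lemma ffun1_linear (f : {ffun 'I_1 -> A} -> M) :
  multilinear f -> linear (fun a => f (ffun1 a)).
Proof.
move=> fL k a b.
have E z : ffun1 z = upd [ffun => 0] ord0 z.
  by apply/ffunP=> i; rewrite !ffunE ord1.
by rewrite !E fL.
Qed.

Lemma delta1E (f : {ffun 'I_1 -> A} -> M) (a b : A) :
  delta f (ffun2 a b) =
  rbm_lact M a (f (ffun1 b)) - f (ffun1 (rba_mul A a b))
  + rbm_ract M (f (ffun1 a)) b.
Proof.
rewrite /delta /hochschild big_ord_recl big_ord0 addr0.
have -> : behead_ffun (ffun2 a b) = ffun1 b.
  by apply/ffunP=> i; rewrite !ffunE.
have -> : belast_ffun (ffun2 a b) = ffun1 a.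
  by apply/ffunP=> i; rewrite !ffunE ord1.
have -> : merge_ffun (rba_mul A) ord0 (ffun2 a b) = ffun1 (rba_mul A a b).
  by apply/ffunP=> i; rewrite !ffunE ord1.
by rewrite !ffunE /= sqrrN expr1n subn0 expr1 scale1r scaleN1r.
Qed.

(** The right-hand side is [D (T a) - TM (D a)], where [D] is the inner
    derivation of the value of [g]; this is what lets the degree 0 part of a
    1-cochain be absorbed into its degree 1 part. *)
Lemma partial0E (g : {ffun 'I_0 -> A} -> M) (a : A) :
  partial g (ffun1 a) =
  ract_op (g empty_ffun) a - lact_op a (g empty_ffun).
Proof.
rewrite /partial /hochschild big_ord0 addr0 expr1 scaleN1r addrC.
have E (s : {ffun 'I_0 -> A}) : s = empty_ffun by apply/ffunP; case.
by rewrite (E (behead_ffun _)) (E (belast_ffun _)) !ffunE.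
Qed.

Lemma Phi1E (f : {ffun 'I_1 -> A} -> M) (a : A) :
  Phi f (ffun1 a) = f (ffun1 (rba_op A a)) - rbm_op M (f (ffun1 a)).
Proof.
rewrite /Phi big_ord_recl big_ord0 addr0 /= expr0 scale1r.
(* In arity 1 only [k = 0] occurs, that is, the empty set of positions. *)
rewrite (big_pred1 set0) => [|S]; last exact: cards_eq0.
congr (f _ - rbm_op M (f _)); apply/ffunP=> i; rewrite !ffunE //.
by rewrite in_set0.
Qed.

End LowDegreeCochains.

Theorem proposition7p8 (K : fieldType) (charK : [pchar K] =i pred0)
    (lambda : K) (A : rb_algebra lambda) (M : rb_bimodule A)
    (c1 c2 : rba_cocycle M 2) :
  cohomologous c1 c2 ->
  isomorphic_extensions (cocycle_extension c1) (cocycle_extension c2).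
Proof.
move=> [[f g] [[/= fL _] E]].
pose x := g (empty_ffun A).
pose f1 (a : A) : M := f (ffun1 a).
pose f1L := GRing.isLinear.Build K A M *:%R f1 (ffun1_linear fL).
pose F : {linear A -> M} := HB.pack f1 f1L.
(* The sign of the inner derivation is the one for which [TM (D a) - D (T a)]
   is the contribution of [x] to the operator component. *)
pose eta : {linear A -> M} := F \+ inner_derivation x.
apply: (isomorphic_extensions_of_linear (eta := eta)) => [a b|a].
- have -> : psi_of c1 a b - psi_of c2 a b = delta f (ffun2 a b) :=
    congr1 (fun h => h.1 (ffun2 a b)) E.
  rewrite delta1E /= linearDr linearDl /= inner_derivationM.
  move: (rbm_lact M a (inner_derivation x b)) => u.
  move: (rbm_ract M (inner_derivation x a) b) => v.
  rewrite !opprD !addrA [RHS](ACl (1*3*6*(2*4)*(5*7))) /= subrr addr0.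
  by rewrite addNr addr0.
- have -> : chi_of c1 a - chi_of c2 a =
      - partial g (ffun1 a) - Phi f (ffun1 a) :=
    congr1 (fun h => h.2 (ffun1 a)) E.
  rewrite partial0E Phi1E /= -/x /inner_derivation /ract_op /lact_op /f1.
  rewrite !(opprB, opprD, opprK) !addrA.
  rewrite [X in _ = X - _ + _ - _]linearB /= linearD /=.
  by rewrite [LHS](ACl (5*3*2*6*1*4)).
Qed.
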